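(* Let $D>0$ be an integer that is not a perfect square and let $k$ be a nonzero integer. Let $u+v\sqrt{D}$ be an element of $\mathbb{Z}_1(\sqrt{D})\setminus\{-1,1\}$. Let $s_0+t_0\sqrt{D}\in\mathbb{Z}_k(\sqrt{D})$. For each integer $n\ge 0$ define integers $s_n,t_n$ by $s_n+t_n\sqrt{D}=(s_0+t_0\sqrt{D})\cdot(u+v\sqrt{D})^n$. Then both sequences $(s_n:n\ge 0)$ and $(t_n:n\ge0)$ are strong Benford sequences.
   Context: For a positive non-square integer $D$, $\mathbb{Z}(\sqrt{D})=\{a+b\sqrt{D}:a,b\in\mathbb{Z}\}$; the norm of $a+b\sqrt{D}$ is $a^2-Db^2$, and $\mathbb{Z}_k(\sqrt{D})$ is the set of elements of norm $k$. For a nonzero real number $x$ and $j\ge1$, $D_j(x)$ denotes the $j$-th most significant decimal digit of $|x|$ (so $D_1(x)\in\{1,\dots,9\}$ is the leading nonzero digit). A sequence $(s_n)$ of real numbers is a strong Benford sequence if every $s_n\neq0$ and for every positive integer $m$, every $d_1\in\{1,\dots,9\}$ and every $d_2,\dots,d_m\in\{0,\dots,9\}$, $$\lim_{N\to\infty}\frac{|\{1\le n\le N: D_j(s_n)=d_j \text{ for } 1\le j\le m\}|}{N}=\log_{10}\Big(1+\frac{1}{\sum_{j=1}^m 10^{m-j}d_j}\Big).$$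
   Formalization: A term may vanish (D=2, unit 3+2√2, start 1 gives t_0=0), so ''every term is nonzero'' is replaced by ''all but finitely many''; all digit-frequency limits are proved in general, and each sequence is strong Benford exactly as defined if none of its terms is zero. *)

(* Defs.v *)
From Stdlib Require Import Reals ZArith List Bool.
From Coquelicot Require Import Coquelicot.
Open Scope R_scope.

Definition quad (D a b : Z) : R := IZR a + IZR b * sqrt (IZR D).

(* For non-square D the coordinates a, b are determined by x, so the norm of x
   is well defined. *)
Definition Zsqrt_norm (D k : Z) (x : R) : Prop :=
  exists a b : Z, x = quad D a b /\ (a ^ 2 - D * b ^ 2 = k)%Z.

Definition log10 (x : R) : R := ln x / ln 10.

(* The j-th (j >= 1) most significant decimal digit of |x|: with
   10 ^ e <= |x| < 10 ^ (e + 1), the units digit of |x| * 10 ^ (j - 1 - e).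
   [Int_part] is the floor.  For the junk argument x = 0 every digit is 0, so
   that x = 0 never has a leading digit in {1, ..., 9}. *)
Definition sig_digit (j : nat) (x : R) : Z :=
  let e := Int_part (log10 (Rabs x)) in
  (Int_part (Rabs x * powerRZ 10 (Z.of_nat j - 1 - e)) mod 10)%Z.

Definition has_digits (m : nat) (d : nat -> Z) (x : R) : bool :=
  forallb (fun j => Z.eqb (sig_digit j x) (d j)) (List.seq 1 m).

Definition digit_count (s : nat -> R) (m : nat) (d : nat -> Z) (N : nat) : nat :=
  length (filter (fun n => has_digits m d (s n)) (List.seq 1 N)).

(* Only the values d 1, ..., d m are used. *)
Definition benford_frequencies (s : nat -> R) : Prop :=
  forall (m : nat) (d : nat -> Z),
    (1 <= m)%nat ->
    (1 <= d 1%nat <= 9)%Z ->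
    (forall j : nat, (2 <= j <= m)%nat -> (0 <= d j <= 9)%Z) ->
    is_lim_seq
      (fun N : nat => INR (digit_count s m d N) / INR N)
      (log10 (1 + 1 / sum_n_m (fun j : nat => 10 ^ (m - j) * IZR (d j)) 1 m)).

Definition strong_benford (s : nat -> R) : Prop :=
  (forall n : nat, s n <> 0) /\ benford_frequencies s.

(* [strong_benford] with "every term is nonzero" relaxed to "all but finitely
   many terms are nonzero"; a zero term matches no digit pattern.  Needed because
   quadratic sequences such as the t-coordinates of (3 + 2 sqrt 2) ^ n
   may pass through 0. *)
Definition strong_benford_off_zeros (s : nat -> R) : Prop :=
  (exists n0 : nat, forall n : nat, (n0 <= n)%nat -> s n <> 0) /\
  benford_frequencies s.

(* Main.v *)
Require Import Defs.
From Stdlib Require Import Reals ZArith List Bool Permutation Lia Lra.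
From Coquelicot Require Import Coquelicot.
Open Scope R_scope.

(** The coordinates of [(s0 + t0 sqrt D) e ^ n] are combinations [A e ^ n + B e' ^ n] of the powers
    of the unit [e = u + v sqrt D] and of its conjugate [e' = 1 / e], with [A] and [B] nonzero, so
    their consecutive ratios tend to whichever of [e], [e'] is larger in absolute value, say [q],
    and the increments of their decimal logarithms to [log10 |q|].  This number is irrational:
    otherwise a positive power of [q] would be a rational unit, hence [1] or [-1].
    A digit pattern is the condition that the decimal logarithm lies in a given arc of [R / Z], so
    it remains to prove equidistribution of a sequence whose increments tend to an irrational
    number.  Since the multiples of that number are dense modulo 1, some shift of the sequence maps
    the visits to an arc into the visits to any given longer arc.  Hence an arc shorter than [1 / K]
    is visited at most as often as each of [K] disjoint arcs of length [1 / K], so it has upper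
    density at most [1 / K]; covering gives upper density at most [l] for every arc of length [l],
    and the complementary arc turns this bound into a limit. *)

(** * Counting *)

Definition count (P : nat -> bool) (N : nat) : nat :=
  length (filter P (List.seq 1 N)).

Lemma count_succ (P : nat -> bool) (N : nat) :
  count P (S N) = (count P N + if P (S N) then 1 else 0)%nat.
Proof.
unfold count; rewrite seq_S, filter_app, length_app; simpl.
now destruct (P (S N)).
Qed.

Lemma count_le (P : nat -> bool) (N : nat) : (count P N <= N)%nat.
Proof. rewrite <- (length_seq N 1) at 2; apply filter_length_le. Qed.

Lemma count_negb (P : nat -> bool) (N : nat) :
  (count P N + count (fun n => negb (P n)) N = N)%nat.
Proof. rewrite <- (length_seq N 1) at 3; apply filter_length. Qed.

Lemma count_orb_le (P Q : nat -> bool) (N : nat) :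
  (count (fun n => P n || Q n) N <= count P N + count Q N)%nat.
Proof.
induction N as [|N IH]; [easy|].
rewrite !count_succ; destruct (P (S N)), (Q (S N)); simpl; lia.
Qed.

Lemma count_add_le (P : nat -> bool) (N k : nat) :
  (count P (N + k) <= count P N + k)%nat.
Proof.
induction k as [|k IH]; [rewrite Nat.add_0_r; lia|].
rewrite Nat.add_succ_r, count_succ; destruct (P _); lia.
Qed.

Definition count_dominated (P Q : nat -> bool) : Prop :=
  exists C : nat, forall N : nat, (count P N <= count Q N + C)%nat.

Lemma count_dominated_trans (P Q S : nat -> bool) :
  count_dominated P Q -> count_dominated Q S -> count_dominated P S.
Proof.
intros [C PQ] [C' QS]; exists (C + C')%nat; intros N.
specialize (PQ N); specialize (QS N); lia.
Qed.

Lemma count_dominated_shift (P Q : nat -> bool) (k : nat) :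
  eventually (fun n => P n = true -> Q (n + k)%nat = true) ->
  count_dominated P Q.
Proof.
intros [n0 PQ]; exists (n0 + k)%nat; intros N.
enough (count P N <= count Q (N + k) + n0)%nat
  by (generalize (count_add_le Q N k); lia).
induction N as [|N IH]; [apply Nat.le_0_l|].
destruct (Nat.le_gt_cases n0 (S N)) as [late|early].
- specialize (PQ _ late); simpl in PQ |- *; rewrite !count_succ.
  destruct (P (S N)); [rewrite PQ by easy|]; lia.
- generalize (count_le P (S N)); lia.
Qed.

Lemma count_dominated_eventually (P Q : nat -> bool) :
  eventually (fun n => P n = true -> Q n = true) -> count_dominated P Q.
Proof.
intros PQ; apply (count_dominated_shift P Q 0).
revert PQ; apply filter_imp; intros n; now rewrite Nat.add_0_r.
Qed.

Lemma count_ltb_succ (g : nat -> nat) (K N : nat) :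
  count (fun n => g n <? S K)%nat N =
  (count (fun n => g n <? K)%nat N + count (fun n => g n =? K)%nat N)%nat.
Proof.
induction N as [|N IH]; [easy|]; rewrite !count_succ, IH.
destruct (Nat.ltb_spec (g (S N)) (S K)), (Nat.ltb_spec (g (S N)) K),
  (Nat.eqb_spec (g (S N)) K); lia.
Qed.

Lemma mul_count_le_of_dominated_fibres (P : nat -> bool) (g : nat -> nat) (K : nat) :
  (forall i, (i < K)%nat -> count_dominated P (fun n => g n =? i)%nat) ->
  exists C : nat, forall N : nat, (K * count P N <= N + C)%nat.
Proof.
intros fibres.
enough (exists C : nat, forall N : nat,
  (K * count P N <= count (fun n => g n <? K)%nat N + C)%nat) as [C bound].
{ exists C; intros N; specialize (bound N).
  generalize (count_le (fun n => g n <? K)%nat N); lia. }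
induction K as [|K IH]; [exists 0%nat; intros; lia|].
destruct IH as [C bound]; [intros; apply fibres; lia|].
destruct (fibres K) as [C' bound']; [lia|].
exists (C + C')%nat; intros N; specialize (bound N); specialize (bound' N).
rewrite count_ltb_succ; lia.
Qed.

(** * Upper density *)

Definition upper_density_le (P : nat -> bool) (r : R) : Prop :=
  forall e : R, 0 < e ->
  exists C : R, forall N : nat, INR (count P N) <= (r + e) * INR N + C.

Lemma upper_density_le_dominated (P Q : nat -> bool) (r : R) :
  count_dominated P Q -> upper_density_le Q r -> upper_density_le P r.
Proof.
intros [C PQ] Qr e e_pos; destruct (Qr e e_pos) as [C' bound].
exists (C' + INR C); intros N; specialize (bound N).
generalize (le_INR _ _ (PQ N)); rewrite plus_INR; lra.
Qed.

Lemma upper_density_le_orb (P Q : nat -> bool) (r r' : R) :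
  upper_density_le P r -> upper_density_le Q r' ->
  upper_density_le (fun n => P n || Q n) (r + r').
Proof.
intros Pr Qr' e e_pos.
destruct (Pr (e / 2)) as [C bound]; [lra|].
destruct (Qr' (e / 2)) as [C' bound']; [lra|].
exists (C + C'); intros N; specialize (bound N); specialize (bound' N).
generalize (le_INR _ _ (count_orb_le P Q N)); rewrite plus_INR; lra.
Qed.

Lemma upper_density_le_weaken (P : nat -> bool) (r r' : R) :
  r <= r' -> upper_density_le P r -> upper_density_le P r'.
Proof.
intros rr' Pr e e_pos; destruct (Pr e e_pos) as [C bound]; exists C; intros N.
specialize (bound N); generalize (pos_INR N); nra.
Qed.

Lemma upper_density_le_of_forall_gt (P : nat -> bool) (r : R) :
  (forall r', r < r' -> upper_density_le P r') -> upper_density_le P r.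
Proof.
intros Pr e e_pos.
destruct (Pr (r + e / 2) ltac:(lra) (e / 2)) as [C bound]; [lra|].
exists C; intros N; specialize (bound N); lra.
Qed.

Lemma upper_density_le_of_dominated_fibres (P : nat -> bool) (g : nat -> nat) (K : nat) :
  (0 < K)%nat ->
  (forall i, (i < K)%nat -> count_dominated P (fun n => g n =? i)%nat) ->
  upper_density_le P (/ INR K).
Proof.
intros K_pos fibres e e_pos; apply lt_0_INR in K_pos.
destruct (mul_count_le_of_dominated_fibres P g K fibres) as [C bound].
exists (/ INR K * INR C); intros N.
specialize (bound N); apply le_INR in bound; rewrite mult_INR, plus_INR in bound.
assert (INR (count P N) <= / INR K * (INR N + INR C)).
{ apply Rmult_le_reg_l with (INR K); [easy|].
  now rewrite <- Rmult_assoc, Rinv_r, Rmult_1_l by lra. }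
generalize (pos_INR N); nra.
Qed.

Lemma is_lim_seq_of_upper_densities (P : nat -> bool) (r : R) :
  upper_density_le P r -> upper_density_le (fun n => negb (P n)) (1 - r) ->
  is_lim_seq (fun N => INR (count P N) / INR N) r.
Proof.
intros Pr negPr; apply is_lim_seq_spec; intros e; simpl.
assert (e_pos := cond_pos e).
destruct (Pr (e / 2)) as [C above]; [lra|].
destruct (negPr (e / 2)) as [C' below]; [lra|].
destruct (INR_unbounded (2 / e * Rmax C C')) as [N0 N0_large].
exists (S N0); intros N N_gt.
apply lt_INR in N_gt; assert (N0_ge0 := pos_INR N0).
assert (C_small : Rmax C C' < e / 2 * INR N).
{ replace (Rmax C C') with (e / 2 * (2 / e * Rmax C C')) by (field; lra).
  apply Rmult_lt_compat_l; lra. }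
assert (C_le := Rmax_l C C'); assert (C'_le := Rmax_r C C').
specialize (above N); specialize (below N).
assert (total := f_equal INR (count_negb P N)); rewrite plus_INR in total.
replace (INR (count P N) / INR N - r) with ((INR (count P N) - r * INR N) / INR N)
  by (field; lra).
rewrite Rabs_div, (Rabs_pos_eq (INR N)) by lra.
apply Rlt_div_l; [lra|]; apply Rabs_def1; nra.
Qed.

(** * Irrational rotations *)

Definition irrational (x : R) : Prop :=
  forall p q : Z, q <> 0%Z -> IZR q * x <> IZR p.

Lemma irrational_Rabs (x : R) : irrational x -> irrational (Rabs x).
Proof.
intros x_irr p q q_neq0 abs_rational; destruct (Rcase_abs x) as [x_neg|x_nneg].
- apply (x_irr (- p)%Z q q_neq0); rewrite Rabs_left in abs_rational by easy.
  rewrite opp_IZR; lra.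
- apply (x_irr p q q_neq0); now rewrite Rabs_right in abs_rational.
Qed.

Lemma frac_part_unique (x f : R) (z : Z) :
  0 <= f < 1 -> x = IZR z + f -> frac_part x = f.
Proof. intros f_bounds x_eq; now destruct (Int_part_frac_part_spec x z f f_bounds x_eq). Qed.

Definition frac_slot (K : nat) (x : R) : nat := Z.to_nat (Int_part (INR K * frac_part x)).

Lemma frac_slot_eq_iff (K i : nat) (x : R) :
  frac_slot K x = i <-> INR i <= INR K * frac_part x < INR i + 1.
Proof.
unfold frac_slot.
assert (scaled_ge0 : 0 <= INR K * frac_part x).
{ apply Rmult_le_pos; [apply pos_INR|]; destruct (base_fp x); lra. }
destruct (base_Int_part (INR K * frac_part x)) as [lower upper].
assert (Int_part_ge0 : (0 <= Int_part (INR K * frac_part x))%Z).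
{ apply Z.lt_pred_le, lt_IZR; simpl; lra. }
split.
- intros <-; rewrite INR_IZR_INZ, Z2Nat.id by easy; lra.
- intros bounds; rewrite <- (Int_part_spec _ (Z.of_nat i)); [apply Nat2Z.id|].
  rewrite <- INR_IZR_INZ; lra.
Qed.

Lemma frac_slot_lt (K : nat) (x : R) : (0 < K)%nat -> (frac_slot K x < K)%nat.
Proof.
intros K_pos; apply INR_lt.
destruct (proj1 (frac_slot_eq_iff K _ x) eq_refl) as [lower _].
destruct (base_fp x) as [_ frac_lt1]; apply lt_0_INR in K_pos; nra.
Qed.

Lemma frac_slot_eq_near (K : nat) (x y : R) :
  (0 < K)%nat -> frac_slot K x = frac_slot K y ->
  Rabs (frac_part y - frac_part x) < / INR K.
Proof.
intros K_pos same; apply lt_0_INR in K_pos; symmetry in same.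
apply frac_slot_eq_iff in same.
destruct (proj1 (frac_slot_eq_iff K _ x) eq_refl) as [lower upper].
rewrite <- (Rmult_1_l (/ INR K)); apply Rlt_div_r; [easy|].
rewrite <- (Rabs_pos_eq (INR K)), <- Rabs_mult by lra.
apply Rabs_def1; lra.
Qed.

Lemma pigeonhole_lt (f : nat -> nat) (K : nat) :
  (forall j, (f j < K)%nat) -> exists i j, (i < j)%nat /\ f i = f j.
Proof.
intros f_lt.
destruct (@Permutation_pigeonhole_rel _ _ (fun j i => f j = i)
            (List.seq 0 (S K)) (List.seq 0 K)) as [i [j [l [perm [a [_ [fi fj]]]]]]].
- apply Forall_forall; intros j _; apply Exists_exists; exists (f j).
  split; [apply in_seq; specialize (f_lt j); lia|easy].
- rewrite !length_seq; lia.
- assert (i_neq_j : i <> j).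
  { intros <-; generalize (Permutation_NoDup perm (seq_NoDup _ _)); intros nodup.
    inversion nodup as [|? ? notin]; apply notin; now left. }
  destruct (Nat.lt_total i j) as [i_lt_j|[i_eq_j|j_lt_i]]; [|easy|].
  + exists i, j; split; congruence.
  + exists j, i; split; congruence.
Qed.

Lemma irrational_multiple_near_integer (x e : R) : irrational x -> 0 < e ->
  exists (k : nat) (z : Z), 0 < Rabs (INR k * x - IZR z) < e.
Proof.
intros x_irr e_pos.
destruct (archimed_cor1 e e_pos) as [K [K_large K_pos]].
destruct (pigeonhole_lt (fun j => frac_slot K (INR j * x)) K) as [i [j [lt_ij same]]].
{ intros j; now apply frac_slot_lt. }
exists (j - i)%nat, (Int_part (INR j * x) - Int_part (INR i * x))%Z.
split.
- apply Rabs_pos_lt; intros diff_eq0; rewrite INR_IZR_INZ in diff_eq0.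
  apply (x_irr (Int_part (INR j * x) - Int_part (INR i * x))%Z (Z.of_nat (j - i)));
    [lia|lra].
- rewrite minus_INR, minus_IZR by lia.
  replace (_ - _) with (frac_part (INR j * x) - frac_part (INR i * x))
    by (unfold frac_part; ring).
  apply frac_slot_eq_near in same; [lra|easy].
Qed.

Lemma irrational_multiples_dense (x a e : R) : irrational x -> 0 < e ->
  exists (k : nat) (z : Z), Rabs (INR k * x - a - IZR z) < e.
Proof.
intros x_irr e_pos.
destruct (irrational_multiple_near_integer x e x_irr e_pos) as [k [z [step_neq0 step_lt]]].
set (step := INR k * x - IZR z) in *.
assert (step <> 0) by (intros step_eq0; rewrite step_eq0, Rabs_R0 in step_neq0; lra).
assert (lift : exists w : Z, 0 <= (a + IZR w) / step).
{ destruct (Rtotal_order step 0) as [neg|[zero|pos]]; [|easy|].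
  - exists (- up a)%Z; rewrite opp_IZR; destruct (archimed a).
    replace ((a + - IZR (up a)) / step) with ((IZR (up a) - a) / - step) by (field; lra).
    apply Rlt_le, Rdiv_lt_0_compat; lra.
  - exists (up (- a))%Z; destruct (archimed (- a)).
    apply Rlt_le, Rdiv_lt_0_compat; lra. }
destruct lift as [w lift].
destruct (base_Int_part ((a + IZR w) / step)) as [lower upper].
set (m := Int_part ((a + IZR w) / step)) in *.
assert (m_ge0 : (0 <= m)%Z) by (apply Z.lt_pred_le, lt_IZR; simpl; lra).
exists (Z.to_nat m * k)%nat, (m * z + w)%Z.
rewrite mult_INR, (INR_IZR_INZ (Z.to_nat m)), Z2Nat.id, plus_IZR, mult_IZR by easy.
replace (_ - _) with ((IZR m - (a + IZR w) / step) * step)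
  by (unfold step in *; field; easy).
rewrite Rabs_mult; apply Rle_lt_trans with (1 * Rabs step); [|lra].
apply Rmult_le_compat_r; [lra|]; apply Rabs_le; lra.
Qed.

(* The half-open arc [c, c + l) of the circle R / Z. *)
Definition arc (c l y : R) : bool :=
  if Rlt_dec (frac_part (y - c)) l then true else false.

Lemma arcP (c l y : R) : reflect (frac_part (y - c) < l) (arc c l y).
Proof. unfold arc; destruct (Rlt_dec _ l); now constructor. Qed.

Lemma arc_iff_exists (c l y : R) : l <= 1 ->
  (arc c l y = true <-> exists z : Z, c <= y - IZR z < c + l).
Proof.
intros l_le1; rewrite <- (reflect_iff _ _ (arcP c l y)); split.
- intros frac_lt; exists (Int_part (y - c)).
  destruct (base_fp (y - c)); unfold frac_part in *; lra.
- intros [z bounds]; rewrite (frac_part_unique (y - c) (y - c - IZR z) z); lra.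
Qed.

Lemma arc_iff_frac_part (c l y : R) (z : Z) : IZR z <= c -> c + l <= IZR z + 1 ->
  (arc c l y = true <-> c <= frac_part y + IZR z < c + l).
Proof.
intros c_ge cl_le; rewrite arc_iff_exists by lra; split.
- intros [w bounds].
  rewrite (frac_part_unique y (y - IZR (w + z)) (w + z)); rewrite ?plus_IZR; lra.
- intros bounds; exists (Int_part y - z)%Z; rewrite minus_IZR.
  unfold frac_part in bounds; lra.
Qed.

Lemma frac_part_sub_outside_arc (c l y : R) : 0 <= l -> arc c l y = false ->
  frac_part (y - (c + l)) = frac_part (y - c) - l.
Proof.
intros l_ge0 outside; destruct (arcP c l y) as [|not_lt]; [easy|].
destruct (base_fp (y - c)).
apply (frac_part_unique _ _ (Int_part (y - c))); [lra|unfold frac_part; ring].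
Qed.

Lemma arc_add (c l l' y : R) : 0 <= l -> 0 <= l' ->
  arc c (l + l') y = arc c l y || arc (c + l) l' y.
Proof.
intros l_ge0 l'_ge0; destruct (arc c l y) eqn:inside; simpl.
- destruct (arcP c l y), (arcP c (l + l') y); [easy|lra|easy|easy].
- assert (shift := frac_part_sub_outside_arc c l y l_ge0 inside).
  destruct (arcP (c + l) l' y), (arcP c (l + l') y); [easy|lra|lra|easy].
Qed.

Lemma arc_compl (c l y : R) : 0 <= l <= 1 -> arc (c + l) (1 - l) y = negb (arc c l y).
Proof.
intros l_bounds; destruct (base_fp (y - c)), (arc c l y) eqn:inside; simpl.
- destruct (arcP c l y) as [frac_lt|]; [|easy].
  destruct (arcP (c + l) (1 - l) y) as [beyond|]; [|easy].
  rewrite (frac_part_unique _ (frac_part (y - c) - l + 1) (Int_part (y - c) - 1)) in beyond;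
    [lra|lra|unfold frac_part; rewrite minus_IZR; ring].
- assert (shift := frac_part_sub_outside_arc c l y (proj1 l_bounds) inside).
  destruct (arcP (c + l) (1 - l) y); [easy|lra].
Qed.

Lemma arc_frac_slot (K i : nat) (y : R) : (i < K)%nat ->
  arc (INR i / INR K) (/ INR K) y = true -> frac_slot K y = i.
Proof.
intros lt_iK.
assert (K_pos : 0 < INR K) by (apply lt_0_INR; lia).
assert (i_succ_le : (INR i + 1) * / INR K <= 1).
{ apply Rle_div_l; [easy|]; rewrite Rmult_1_l, <- S_INR; apply le_INR; lia. }
assert (i_ge0 : 0 <= INR i / INR K) by (apply Rdiv_le_0_compat; [apply pos_INR|easy]).
rewrite (arc_iff_frac_part _ _ _ 0) by lra; rewrite Rplus_0_r; intros [lower upper].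
apply frac_slot_eq_iff; rewrite (Rmult_comm (INR K)); split.
- now apply Rle_div_l.
- apply Rlt_div_r; [easy|]; unfold Rdiv in *; lra.
Qed.

Lemma is_lim_seq_diff_add (y : nat -> R) (x : R) (k : nat) :
  is_lim_seq (fun n => y (S n) - y n) x ->
  is_lim_seq (fun n => y (n + k)%nat - y n) (INR k * x).
Proof.
intros steps; induction k as [|k IH].
- apply is_lim_seq_ext with (fun _ => 0).
  + intros n; rewrite Nat.add_0_r; ring.
  + simpl; rewrite Rmult_0_l; apply is_lim_seq_const.
- apply is_lim_seq_ext
    with (fun n => (y (S (n + k)) - y (n + k)%nat) + (y (n + k)%nat - y n)).
  + intros n; rewrite Nat.add_succ_r; ring.
  + rewrite S_INR, Rmult_plus_distr_r, Rmult_1_l, Rplus_comm.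
    apply is_lim_seq_plus'; [|exact IH].
    now apply (is_lim_seq_incr_n (fun n => y (S n) - y n) k).
Qed.

Section Rotation.

Variables (y : nat -> R) (x : R).
Hypothesis x_irr : irrational x.
Hypothesis y_step : is_lim_seq (fun n => y (S n) - y n) x.

Lemma arc_dominated_longer_arc (c l c' l' : R) : l < l' <= 1 ->
  count_dominated (fun n => arc c l (y n)) (fun n => arc c' l' (y n)).
Proof.
intros l'_bounds; set (e := (l' - l) / 4).
assert (e_pos : 0 < e) by (unfold e; lra).
destruct (irrational_multiples_dense x (c' - c + 2 * e) e x_irr e_pos) as [k [z near]].
assert (shifts := is_lim_seq_diff_add y x k y_step).
apply is_lim_seq_spec in shifts; specialize (shifts (mkposreal e e_pos)).
apply (count_dominated_shift _ _ k); revert shifts; apply filter_imp; simpl.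
intros n close in_arc.
apply arc_iff_exists in in_arc; [destruct in_arc as [w in_arc]|lra].
apply arc_iff_exists; [easy|]; exists (w + z)%Z; rewrite plus_IZR.
apply Rabs_def2 in near, close; unfold e in *; lra.
Qed.

Lemma upper_density_le_short_arc (c l : R) (K : nat) :
  (0 < K)%nat -> l < / INR K ->
  upper_density_le (fun n => arc c l (y n)) (/ INR K).
Proof.
intros K_pos l_lt.
apply (upper_density_le_of_dominated_fibres _ (fun n => frac_slot K (y n))); [easy|].
intros i lt_iK.
apply count_dominated_trans with (fun n => arc (INR i / INR K) (/ INR K) (y n)).
- apply arc_dominated_longer_arc; split; [easy|].
  rewrite <- Rinv_1; apply Rinv_le_contravar; [lra|now apply (le_INR 1)].
- apply count_dominated_eventually; exists 0%nat; intros n _ in_arc.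
  now apply Nat.eqb_eq, arc_frac_slot.
Qed.

Lemma upper_density_le_arc_mul (l r : R) (p : nat) : 0 <= l ->
  (forall c, upper_density_le (fun n => arc c l (y n)) r) ->
  forall c, upper_density_le (fun n => arc c (INR (S p) * l) (y n)) (INR (S p) * r).
Proof.
intros l_ge0 short c; induction p as [|p IH]; [now simpl; rewrite !Rmult_1_l|].
rewrite (S_INR (S p)), !Rmult_plus_distr_r, !Rmult_1_l.
apply (upper_density_le_dominated _ _ _)
  with (2 := upper_density_le_orb _ _ _ _ IH (short (c + INR (S p) * l))).
apply count_dominated_eventually; exists 0%nat; intros n _ in_arc.
rewrite arc_add in in_arc; [exact in_arc| |easy].
apply Rmult_le_pos; [apply pos_INR|easy].
Qed.

Lemma upper_density_le_arc (c l : R) : 0 <= l ->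
  upper_density_le (fun n => arc c l (y n)) l.
Proof.
intros l_ge0; apply upper_density_le_of_forall_gt; intros r lt_lr.
destruct (archimed_cor1 (r - l)) as [K [K_large K_pos]]; [lra|].
assert (INR_K_pos := lt_0_INR _ K_pos).
destruct (nfloor_ex (l * INR K)) as [p [p_le p_gt]]; [apply Rmult_le_pos; lra|].
assert (p_ge0 := pos_INR p); assert (p_succ := S_INR p).
apply upper_density_le_weaken with (INR (S p) * / INR K).
- assert (gap : 1 < (r - l) * INR K) by (apply Rlt_div_l; lra).
  apply Rle_div_l; lra.
- replace l with (INR (S p) * (l / INR (S p))) by (field; lra).
  apply upper_density_le_arc_mul; [apply Rdiv_le_0_compat; lra|].
  intros c'; apply upper_density_le_short_arc; [easy|].
  apply Rlt_div_l; [lra|]; rewrite Rmult_comm; apply Rlt_div_r; lra.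
Qed.

Lemma is_lim_seq_arc_frequency (P : nat -> bool) (c l : R) : 0 <= l <= 1 ->
  eventually (fun n => P n = arc c l (y n)) ->
  is_lim_seq (fun N => INR (count P N) / INR N) l.
Proof.
intros l_bounds P_arc; apply is_lim_seq_of_upper_densities.
- apply upper_density_le_dominated with (fun n => arc c l (y n)).
  + apply count_dominated_eventually; revert P_arc; apply filter_imp.
    intros n ->; easy.
  + now apply upper_density_le_arc.
- apply upper_density_le_dominated with (fun n => arc (c + l) (1 - l) (y n)).
  + apply count_dominated_eventually; revert P_arc; apply filter_imp.
    intros n ->; now rewrite arc_compl.
  + apply upper_density_le_arc; lra.
Qed.

End Rotation.

(** * Decimal logarithms *)

Lemma ln10_pos : 0 < ln 10.
Proof. rewrite <- ln_1; apply ln_increasing; lra. Qed.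

Lemma log10_1 : log10 1 = 0.
Proof. unfold log10; rewrite ln_1; apply Rdiv_0_l. Qed.

Lemma log10_10 : log10 10 = 1.
Proof. apply Rdiv_diag, Rgt_not_eq, ln10_pos. Qed.

Lemma log10_lt_iff (a b : R) : 0 < a -> 0 < b -> a < b <-> log10 a < log10 b.
Proof.
intros a_pos b_pos; assert (inv_pos := Rinv_0_lt_compat _ ln10_pos); unfold log10; split.
- intros a_lt_b; now apply Rmult_lt_compat_r, ln_increasing.
- intros ln_lt; apply Rmult_lt_reg_r in ln_lt; [now apply ln_lt_inv|easy].
Qed.

Lemma log10_le_iff (a b : R) : 0 < a -> 0 < b -> a <= b <-> log10 a <= log10 b.
Proof. intros a_pos b_pos; assert (b_lt_a := log10_lt_iff b a b_pos a_pos); lra. Qed.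

Lemma log10_inj (a b : R) : 0 < a -> 0 < b -> log10 a = log10 b -> a = b.
Proof. intros a_pos b_pos log10_eq; apply Rle_antisym; apply <- log10_le_iff; lra. Qed.

Lemma log10_mult (a b : R) : 0 < a -> 0 < b -> log10 (a * b) = log10 a + log10 b.
Proof. intros a_pos b_pos; unfold log10; rewrite ln_mult by easy; apply Rdiv_plus_distr. Qed.

Lemma log10_div (a b : R) : 0 < a -> 0 < b -> log10 (a / b) = log10 a - log10 b.
Proof. intros a_pos b_pos; unfold log10; rewrite ln_div by easy; apply Rmult_minus_distr_r. Qed.

Lemma log10_pow (a : R) (n : nat) : 0 < a -> log10 (a ^ n) = INR n * log10 a.
Proof. intros a_pos; unfold log10; rewrite ln_pow by easy; apply Rmult_assoc. Qed.

Lemma log10_powerRZ_10 (z : Z) : log10 (powerRZ 10 z) = IZR z.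
Proof.
rewrite powerRZ_Rpower by lra; unfold log10, Rpower; rewrite ln_exp.
apply Rmult_inv_r_id_l, Rgt_not_eq, ln10_pos.
Qed.

Lemma is_lim_seq_log10 (u : nat -> R) (l : R) : 0 < l ->
  is_lim_seq u l -> is_lim_seq (fun n => log10 (u n)) (log10 l).
Proof.
intros l_pos lim; apply (is_lim_seq_div' (fun n => ln (u n)) (fun _ => ln 10)).
- apply (filterlim_comp _ _ _ u ln _ (locally l)); [exact lim|now apply continuous_ln].
- apply is_lim_seq_const.
- apply Rgt_not_eq, ln10_pos.
Qed.

Lemma irrational_log10 (a : R) : 0 < a ->
  (forall n, (0 < n)%nat -> irrational (a ^ n)) -> irrational (log10 a).
Proof.
intros a_pos pow_irr.
assert (nat_multiple : forall (n : nat) (p : Z), (0 < n)%nat -> INR n * log10 a <> IZR p).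
{ intros n p n_pos log_eq.
  rewrite <- log10_pow, <- log10_powerRZ_10 in log_eq by easy.
  apply log10_inj in log_eq as pow_eq; [|now apply pow_lt|apply powerRZ_lt; lra].
  destruct p as [|p|p]; simpl in pow_eq.
  - apply (pow_irr n n_pos 1%Z 1%Z); [easy|lra].
  - rewrite pow_IZR in pow_eq.
    apply (pow_irr n n_pos (10 ^ Z.of_nat (Pos.to_nat p))%Z 1%Z); [easy|lra].
  - apply (pow_irr n n_pos 1%Z (10 ^ Z.of_nat (Pos.to_nat p))%Z).
    + apply Z.pow_nonzero; lia.
    + rewrite pow_eq, <- pow_IZR; apply Rinv_r, pow_nonzero; lra. }
intros p q q_neq0 log_rational.
apply (nat_multiple (Z.abs_nat q) (Z.sgn q * p)%Z); [lia|].
rewrite INR_IZR_INZ, Nat2Z.inj_abs_nat, <- Z.sgn_abs, !mult_IZR, <- log_rational; ring.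
Qed.

(** * Decimal digits *)

Fixpoint decimal (d : nat -> Z) (m : nat) : Z :=
  match m with
  | O => 0
  | S m' => (10 * decimal d m' + d m)%Z
  end.

Lemma decimal_succ (d : nat -> Z) (m : nat) :
  decimal d (S m) = (10 * decimal d m + d (S m))%Z.
Proof. reflexivity. Qed.

Lemma sum_pow10_decimal (d : nat -> Z) (m : nat) :
  sum_n_m (fun j : nat => 10 ^ (m - j) * IZR (d j)) 1 m = IZR (decimal d m).
Proof.
induction m as [|m IH]; [now rewrite sum_n_m_zero by lia|].
rewrite sum_n_Sm by lia.
rewrite (sum_n_m_ext_loc _ (fun j => mult 10 (10 ^ (m - j) * IZR (d j)))).
- assert (factor := sum_n_m_mult_l (K := R_Ring) 10
                      (fun j : nat => 10 ^ (m - j) * IZR (d j)) 1 m).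
  rewrite (eq_trans factor (f_equal (mult 10) IH)), Nat.sub_diag.
  rewrite decimal_succ, plus_IZR, mult_IZR; unfold plus, mult; simpl; ring.
- intros j j_le; replace (S m - j)%nat with (S (m - j)) by lia.
  unfold mult; simpl; ring.
Qed.

Definition are_digits (d : nat -> Z) (m : nat) : Prop :=
  forall j : nat, (1 <= j <= m)%nat -> (0 <= d j <= 9)%Z.

Lemma decimal_bounds (d : nat -> Z) (m : nat) :
  are_digits d (S m) -> (1 <= d 1%nat)%Z ->
  10 ^ m <= IZR (decimal d (S m)) <= 10 ^ S m - 1.
Proof.
intros digits d1_ge1; induction m as [|m IH].
- destruct (digits 1%nat) as [_ d1_le9]; [lia|].
  apply IZR_le in d1_ge1, d1_le9; rewrite decimal_succ, plus_IZR; simpl; lra.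
- destruct (digits (S (S m))) as [last_ge0 last_le9]; [lia|].
  apply IZR_le in last_ge0, last_le9.
  destruct IH as [lower upper]; [intros j j_le; apply digits; lia|].
  rewrite decimal_succ, plus_IZR, mult_IZR; simpl pow in *; lra.
Qed.

Lemma decimal_eq_iff (d d' : nat -> Z) (m : nat) : are_digits d m -> are_digits d' m ->
  (decimal d m = decimal d' m <-> forall j, (1 <= j <= m)%nat -> d j = d' j).
Proof.
intros digits digits'; induction m as [|m IH]; [split; [lia|easy]|].
destruct IH as [IH_digits IH_decimal];
  [intros j j_le; apply digits; lia|intros j j_le; apply digits'; lia|].
assert (last := digits (S m) ltac:(lia)); assert (last' := digits' (S m) ltac:(lia)).
rewrite !decimal_succ; split.
- intros decimal_eq j j_le; destruct (Nat.eq_dec j (S m)) as [->|j_neq]; [lia|].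
  apply IH_digits; lia.
- intros agree; rewrite IH_decimal by (intros; apply agree; lia).
  rewrite (agree (S m)); lia.
Qed.

Lemma Int_part_mult_div (a : R) (b : Z) : (0 < b)%Z ->
  (Int_part (a * IZR b) / b = Int_part a)%Z.
Proof.
intros b_pos; apply Int_part_spec.
destruct (base_Int_part (a * IZR b)) as [lower upper].
set (q := Int_part (a * IZR b)) in *.
assert (quotient_le := Z.mul_div_le q b b_pos).
assert (quotient_gt := Z.mul_succ_div_gt q b b_pos).
apply Z.le_succ_l, IZR_le in quotient_gt; apply IZR_le in quotient_le.
rewrite succ_IZR, mult_IZR, succ_IZR in quotient_gt; rewrite mult_IZR in quotient_le.
apply IZR_lt in b_pos; split; nra.
Qed.

Lemma decimal_Int_part (a : R) (m : nat) : 0 <= a < 10 ->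
  decimal (fun j => Int_part (a * 10 ^ (j - 1)) mod 10)%Z (S m) = Int_part (a * 10 ^ m).
Proof.
intros a_bounds; induction m as [|m IH].
- rewrite decimal_succ, Z.add_0_l; apply Z.mod_small.
  destruct (base_Int_part (a * 10 ^ 0)) as [lower upper]; simpl in lower, upper |- *.
  split; [apply Z.lt_pred_le|]; apply lt_IZR; simpl; lra.
- rewrite decimal_succ, IH, <- (Int_part_mult_div (a * 10 ^ m) 10) by easy.
  replace (a * 10 ^ m * IZR 10) with (a * 10 ^ S m) by (simpl; ring).
  symmetry; apply Z_div_mod_eq_full.
Qed.

Definition significand (x : R) : R :=
  Rabs x * powerRZ 10 (- Int_part (log10 (Rabs x))).

Lemma significand_pos (x : R) : x <> 0 -> 0 < significand x.
Proof.
intros x_neq0; apply Rmult_lt_0_compat; [now apply Rabs_pos_lt|apply powerRZ_lt; lra].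
Qed.

Lemma log10_significand (x : R) : x <> 0 ->
  log10 (significand x) = frac_part (log10 (Rabs x)).
Proof.
intros x_neq0; unfold significand.
rewrite log10_mult, log10_powerRZ_10, opp_IZR; [easy|now apply Rabs_pos_lt|].
apply powerRZ_lt; lra.
Qed.

Lemma significand_bounds (x : R) : x <> 0 -> 1 <= significand x < 10.
Proof.
intros x_neq0; assert (pos := significand_pos x x_neq0).
destruct (base_fp (log10 (Rabs x))) as [frac_ge0 frac_lt1].
rewrite log10_le_iff, log10_lt_iff, log10_1, log10_10, log10_significand by (easy || lra).
lra.
Qed.

Lemma sig_digit_significand (j : nat) (x : R) : (1 <= j)%nat ->
  sig_digit j x = (Int_part (significand x * 10 ^ (j - 1)) mod 10)%Z.
Proof.
intros j_ge1; unfold sig_digit, significand; do 2 f_equal.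
rewrite Rmult_assoc, pow_powerRZ, <- powerRZ_add by lra; do 2 f_equal; lia.
Qed.

Lemma has_digits_iff_Int_part (d : nat -> Z) (m : nat) (x : R) :
  x <> 0 -> are_digits d (S m) ->
  (has_digits (S m) d x = true <-> Int_part (significand x * 10 ^ m) = decimal d (S m)).
Proof.
intros x_neq0 digits; assert (bounds := significand_bounds x x_neq0).
rewrite <- decimal_Int_part by lra; rewrite decimal_eq_iff; [|intros j _|exact digits].
- unfold has_digits; rewrite forallb_forall; split.
  + intros match_all j j_le; rewrite <- sig_digit_significand by lia.
    apply Z.eqb_eq, match_all, in_seq; lia.
  + intros agree j j_in; apply in_seq in j_in; apply Z.eqb_eq.
    rewrite sig_digit_significand by lia; apply agree; lia.
- generalize (Z.mod_pos_bound (Int_part (significand x * 10 ^ (j - 1))) 10); lia.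
Qed.

Lemma has_digits_arc (d : nat -> Z) (m : nat) (x : R) :
  x <> 0 -> are_digits d (S m) -> (1 <= d 1%nat)%Z ->
  has_digits (S m) d x =
  arc (log10 (IZR (decimal d (S m))))
      (log10 (1 + 1 / IZR (decimal d (S m)))) (log10 (Rabs x)).
Proof.
intros x_neq0 digits d1_ge1; apply eq_true_iff_eq.
rewrite has_digits_iff_Int_part by easy.
destruct (decimal_bounds d m digits d1_ge1) as [lower upper].
set (M := decimal d (S m)) in *.
assert (pow_ge1 : 1 <= 10 ^ m) by (apply pow_R1_Rle; lra).
assert (upper_end : log10 (IZR M) + log10 (1 + 1 / IZR M) = log10 (IZR M + 1)).
{ rewrite <- log10_mult; [f_equal; field; lra|lra|].
  apply Rplus_lt_0_compat; [lra|apply Rdiv_lt_0_compat; lra]. }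
assert (sig_pos := significand_pos x x_neq0).
assert (scaled_pos : 0 < significand x * 10 ^ m) by (apply Rmult_lt_0_compat; lra).
assert (log10_pow10 : forall n, log10 (10 ^ n) = INR n).
{ intros n; rewrite log10_pow, log10_10 by lra; ring. }
rewrite (arc_iff_frac_part _ _ _ (Z.of_nat m)), upper_end, <- INR_IZR_INZ.
- rewrite <- log10_significand, <- log10_pow10, <- log10_mult by (easy || lra).
  rewrite <- log10_le_iff, <- log10_lt_iff by lra.
  split.
  + intros <-; destruct (base_Int_part (significand x * 10 ^ m)); lra.
  + intros bounds; symmetry; apply Int_part_spec; lra.
- rewrite <- INR_IZR_INZ, <- log10_pow10; apply -> log10_le_iff; lra.
- rewrite upper_end, <- INR_IZR_INZ, <- S_INR, <- log10_pow10; apply -> log10_le_iff; lra.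
Qed.

(** * Benford sequences *)

Lemma benford_of_log10_steps (x : nat -> R) (r : R) :
  eventually (fun n => x n <> 0) -> irrational r ->
  is_lim_seq (fun n => log10 (Rabs (x (S n))) - log10 (Rabs (x n))) r ->
  benford_frequencies x.
Proof.
intros x_neq0 r_irr steps [|m] d m_ge1 d1_bounds d_bounds; [lia|].
assert (digits : are_digits d (S m)).
{ intros j j_le; destruct (Nat.eq_dec j 1) as [->|j_neq1]; [lia|apply d_bounds; lia]. }
rewrite sum_pow10_decimal.
destruct (decimal_bounds d m digits) as [lower upper]; [lia|].
assert (pow_ge1 : 1 <= 10 ^ m) by (apply pow_R1_Rle; lra).
assert (inv_bounds : 0 < 1 / IZR (decimal d (S m)) <= 1).
{ split; [apply Rdiv_lt_0_compat; lra|]; apply <- Rle_div_l; lra. }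
apply (is_lim_seq_arc_frequency _ r r_irr steps
         (fun n => has_digits (S m) d (x n)) (log10 (IZR (decimal d (S m))))).
- split.
  + rewrite <- log10_1; apply -> log10_le_iff; lra.
  + apply Rle_trans with (log10 10); [apply -> log10_le_iff; lra|].
    rewrite log10_10; apply Rle_refl.
- revert x_neq0; apply filter_imp; intros n xn_neq0; apply has_digits_arc; [easy|easy|lia].
Qed.

Lemma is_lim_seq_eventually_neq0 (u : nat -> R) (l : R) :
  is_lim_seq u l -> l <> 0 -> eventually (fun n => u n <> 0).
Proof.
intros lim l_neq0; apply is_lim_seq_spec in lim.
specialize (lim (mkposreal _ (Rabs_pos_lt l l_neq0))); revert lim.
apply filter_imp; simpl; intros n near un_eq0.
rewrite un_eq0, Rminus_0_l, Rabs_Ropp in near; lra.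
Qed.

Lemma strong_benford_off_zeros_of_ratio (x : nat -> R) (q : R) :
  q <> 0 -> irrational (log10 (Rabs q)) ->
  is_lim_seq (fun n => x (S n) / x n) q ->
  strong_benford_off_zeros x.
Proof.
intros q_neq0 log_irr ratio.
assert (ratio_neq0 := is_lim_seq_eventually_neq0 _ _ ratio q_neq0).
(* Since [/ 0 = 0], a nonzero ratio has a nonzero denominator. *)
assert (x_neq0 : eventually (fun n => x n <> 0)).
{ revert ratio_neq0; apply filter_imp; intros n rn_neq0 xn_eq0; apply rn_neq0.
  now rewrite xn_eq0, Rdiv_0_r. }
split; [exact x_neq0|].
apply (benford_of_log10_steps x (log10 (Rabs q)) x_neq0 log_irr).
apply is_lim_seq_ext_loc with (fun n => log10 (Rabs (x (S n) / x n))).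
- generalize (filter_and _ _ ratio_neq0 x_neq0); apply filter_imp.
  intros n [rn_neq0 xn_neq0].
  assert (xSn_neq0 : x (S n) <> 0).
  { intros xSn_eq0; apply rn_neq0; rewrite xSn_eq0; apply Rdiv_0_l. }
  rewrite Rabs_div by easy; apply log10_div; now apply Rabs_pos_lt.
- apply is_lim_seq_log10; [now apply Rabs_pos_lt|].
  now apply (is_lim_seq_abs _ q).
Qed.

Lemma is_lim_seq_ratio_two_powers (A B e e' : R) : A <> 0 -> Rabs e' < Rabs e ->
  is_lim_seq (fun n => (A * e ^ S n + B * e' ^ S n) / (A * e ^ n + B * e' ^ n)) e.
Proof.
intros A_neq0 e'_lt.
assert (e_neq0 : e <> 0).
{ intros e_eq0; rewrite e_eq0, Rabs_R0 in e'_lt; generalize (Rabs_pos e'); lra. }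
assert (quotient_lt1 : Rabs (e' / e) < 1).
{ rewrite Rabs_div by easy; apply Rlt_div_l; [now apply Rabs_pos_lt|lra]. }
set (scaled := fun n => A + B * (e' / e) ^ n).
assert (scaled_lim : is_lim_seq scaled A).
{ rewrite <- (Rplus_0_r A), <- (Rmult_0_r B).
  apply is_lim_seq_plus'; [apply is_lim_seq_const|].
  apply is_lim_seq_mult'; [apply is_lim_seq_const|now apply is_lim_seq_geom]. }
assert (factor : forall n, A * e ^ n + B * e' ^ n = scaled n * e ^ n).
{ intros n; unfold scaled; rewrite Rmult_plus_distr_r, Rmult_assoc, <- Rpow_mult_distr.
  now replace (e' / e * e) with e' by (field; easy). }
apply is_lim_seq_ext_loc with (fun n => e * (scaled (S n) / scaled n)).
- generalize (is_lim_seq_eventually_neq0 _ _ scaled_lim A_neq0); apply filter_imp.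
  intros n scaled_neq0; rewrite !factor; simpl; field.
  split; [now apply pow_nonzero|easy].
- replace e with (e * (A / A)) at 1 by (field; easy).
  apply is_lim_seq_mult'; [apply is_lim_seq_const|].
  apply is_lim_seq_div'; [now apply is_lim_seq_incr_1 in scaled_lim|easy|easy].
Qed.

Lemma strong_benford_off_zeros_dominant_power (x : nat -> R) (A B e e' : R) :
  A <> 0 -> Rabs e' < Rabs e -> irrational (log10 (Rabs e)) ->
  (forall n, x n = A * e ^ n + B * e' ^ n) ->
  strong_benford_off_zeros x.
Proof.
intros A_neq0 e'_lt log_irr x_eq.
apply (strong_benford_off_zeros_of_ratio x e); [|exact log_irr|].
- intros e_eq0; rewrite e_eq0, Rabs_R0 in e'_lt; generalize (Rabs_pos e'); lra.
- apply is_lim_seq_ext with (2 := is_lim_seq_ratio_two_powers A B e e' A_neq0 e'_lt).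
  intros n; now rewrite !x_eq.
Qed.

Lemma strong_benford_off_zeros_two_powers (x : nat -> R) (A B e e' : R) :
  A <> 0 -> B <> 0 -> Rabs e <> Rabs e' ->
  irrational (log10 (Rabs e)) -> irrational (log10 (Rabs e')) ->
  (forall n, x n = A * e ^ n + B * e' ^ n) ->
  strong_benford_off_zeros x.
Proof.
intros A_neq0 B_neq0 abs_neq log_irr log_irr' x_eq.
destruct (Rdichotomy _ _ abs_neq) as [e_lt|e_gt].
- apply (strong_benford_off_zeros_dominant_power x B A e' e); [easy|easy|easy|].
  intros n; rewrite x_eq; apply Rplus_comm.
- now apply (strong_benford_off_zeros_dominant_power x A B e e').
Qed.

Lemma strong_benford_of_off_zeros (x : nat -> R) :
  strong_benford_off_zeros x -> (forall n, x n <> 0) -> strong_benford x.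
Proof. now intros [_ frequencies] x_neq0. Qed.

(** * Quadratic integers *)

Lemma divide_of_square_divide (a b : Z) : (b ^ 2 | a ^ 2)%Z -> (b | a)%Z.
Proof.
intros [c square_eq].
destruct (Z.eq_dec (Z.gcd a b) 0) as [gcd_eq0|gcd_neq0].
{ apply Z.gcd_eq_0 in gcd_eq0; destruct gcd_eq0 as [-> ->]; apply Z.divide_refl. }
assert (coprime := Z.gcd_div_gcd a b _ gcd_neq0 eq_refl).
destruct (Z.gcd_divide_l a b) as [a' a_eq], (Z.gcd_divide_r a b) as [b' b_eq].
set (g := Z.gcd a b) in *.
rewrite a_eq, b_eq, !Z.div_mul in coprime by easy.
rewrite a_eq, b_eq in square_eq |- *.
apply Z.mul_divide_mono_r, Z.gauss with a'; [exists (c * b')%Z|now rewrite Z.gcd_comm].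
apply Z.mul_reg_r with (g ^ 2)%Z; lia.
Qed.

Definition quad_norm (D a b : Z) : Z := (a ^ 2 - D * b ^ 2)%Z.

Lemma quad_norm_opp (D a b : Z) : quad_norm D a (- b) = quad_norm D a b.
Proof. unfold quad_norm; ring. Qed.

Section Quad.

Variable D : Z.
Hypothesis D_pos : (0 < D)%Z.

Lemma quad_mul (a b a' b' : Z) :
  quad D a b * quad D a' b' = quad D (a * a' + D * (b * b')) (a * b' + b * a').
Proof.
unfold quad; rewrite !plus_IZR, !mult_IZR.
generalize (sqrt_sqrt (IZR D) (IZR_le 0 D ltac:(lia))).
generalize (sqrt (IZR D)); intros r <-; ring.
Qed.

Lemma quad_mul_conj (a b : Z) : quad D a b * quad D a (- b) = IZR (quad_norm D a b).
Proof.
rewrite quad_mul; replace (a * - b + b * a)%Z with 0%Z by ring.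
unfold quad; rewrite Rmult_0_l, Rplus_0_r; f_equal; unfold quad_norm; ring.
Qed.

Lemma quad_pow_conj (u v : Z) (n : nat) : exists a b : Z,
  quad D u v ^ n = quad D a b /\ quad D u (- v) ^ n = quad D a (- b).
Proof.
induction n as [|n [a [b [pow_eq pow_conj_eq]]]].
- exists 1%Z, 0%Z; unfold quad; simpl; split; ring.
- exists (u * a + D * (v * b))%Z, (u * b + v * a)%Z; simpl.
  rewrite pow_eq, pow_conj_eq, !quad_mul; split; f_equal; ring.
Qed.

Hypothesis D_nonsquare : ~ exists m : Z, D = (m ^ 2)%Z.

Lemma quad_eq0 (a b : Z) : quad D a b = 0 -> a = 0%Z /\ b = 0%Z.
Proof.
intros eq0.
assert (norm_eq0 : quad_norm D a b = 0%Z).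
{ apply eq_IZR; now rewrite <- quad_mul_conj, eq0, Rmult_0_l. }
unfold quad_norm in norm_eq0.
destruct (Z.eq_dec b 0) as [->|b_neq0]; [split; nia|exfalso].
destruct (divide_of_square_divide a b) as [c ->]; [exists D; lia|].
apply D_nonsquare; exists c; apply Z.mul_reg_r with (b ^ 2)%Z; nia.
Qed.

Lemma quad_inj (a b a' b' : Z) : quad D a b = quad D a' b' -> a = a' /\ b = b'.
Proof.
intros quad_eq; destruct (quad_eq0 (a - a') (b - b')); [|lia].
unfold quad in *; rewrite !minus_IZR; lra.
Qed.

Lemma quad_irrational (a b : Z) : b <> 0%Z -> irrational (quad D a b).
Proof.
intros b_neq0 p q q_neq0 rational.
destruct (quad_eq0 (q * a - p) (q * b)); [|nia].
unfold quad in *; rewrite minus_IZR, !mult_IZR; lra.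
Qed.

Lemma quad_norm_of_Zsqrt_norm (k a b : Z) :
  Zsqrt_norm D k (quad D a b) -> quad_norm D a b = k.
Proof.
intros [a' [b' [quad_eq norm_eq]]].
apply quad_inj in quad_eq; now destruct quad_eq as [-> ->].
Qed.

Lemma quad_mul_pow_conj (a b s t u v : Z) (n : nat) :
  quad D a b = quad D s t * quad D u v ^ n ->
  quad D a (- b) = quad D s (- t) * quad D u (- v) ^ n.
Proof.
destruct (quad_pow_conj u v n) as [u' [v' [-> ->]]]; rewrite !quad_mul.
intros quad_eq; apply quad_inj in quad_eq; destruct quad_eq as [-> ->]; f_equal; ring.
Qed.

Lemma quad_unit_nontrivial (u v : Z) : quad_norm D u v = 1%Z ->
  quad D u v <> 1 -> quad D u v <> -1 -> v <> 0%Z.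
Proof.
intros unit neq1 neqN1 ->.
assert (u = 1 \/ u = -1)%Z as [-> | ->] by (unfold quad_norm in unit; nia);
  unfold quad in *; lra.
Qed.

Lemma quad_unit_pow_irrational (u v : Z) (n : nat) :
  quad_norm D u v = 1%Z -> v <> 0%Z -> (0 < n)%nat ->
  irrational (Rabs (quad D u v) ^ n).
Proof.
intros unit v_neq0 n_pos; rewrite RPow_abs; apply irrational_Rabs.
destruct (quad_pow_conj u v n) as [a [b [pow_eq pow_conj_eq]]].
assert (unit_pow : quad_norm D a b = 1%Z).
{ apply eq_IZR; rewrite <- quad_mul_conj, <- pow_eq, <- pow_conj_eq.
  now rewrite <- Rpow_mult_distr, quad_mul_conj, unit, pow1. }
destruct (Z.eq_dec b 0) as [->|b_neq0]; [exfalso|rewrite pow_eq; now apply quad_irrational].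
assert (pow_abs_eq1 : Rabs (quad D u v) ^ n = 1).
{ rewrite RPow_abs, pow_eq.
  assert (a = 1 \/ a = -1)%Z as [-> | ->] by (unfold quad_norm in unit_pow; nia);
    unfold quad; rewrite Rmult_0_l, Rplus_0_r, <- abs_IZR; easy. }
apply pow_R1 in pow_abs_eq1; rewrite Rabs_Rabsolu in pow_abs_eq1.
destruct pow_abs_eq1 as [abs_eq1|]; [|lia].
apply (irrational_Rabs _ (quad_irrational u v v_neq0) 1%Z 1%Z); [easy|lra].
Qed.

Lemma quad_unit_log10_irrational (u v : Z) : quad_norm D u v = 1%Z -> v <> 0%Z ->
  irrational (log10 (Rabs (quad D u v))).
Proof.
intros unit v_neq0; apply irrational_log10.
- apply Rabs_pos_lt; intros eq0; apply quad_eq0 in eq0; now apply v_neq0.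
- intros n n_pos; now apply quad_unit_pow_irrational.
Qed.

Lemma quad_unit_abs_conj_neq (u v : Z) : quad_norm D u v = 1%Z -> v <> 0%Z ->
  Rabs (quad D u v) <> Rabs (quad D u (- v)).
Proof.
intros unit v_neq0 abs_eq.
apply (quad_unit_pow_irrational u v 2 unit v_neq0) with 1%Z 1%Z; [lia|easy|].
replace (Rabs (quad D u v) ^ 2) with (Rabs (quad D u v) * Rabs (quad D u v)) by ring.
now rewrite abs_eq at 2; rewrite <- Rabs_mult, quad_mul_conj, unit, Rabs_R1, Rmult_1_r.
Qed.

Lemma strong_benford_off_zeros_quad_combination
  (u v s0 t0 : Z) (s t : nat -> Z) :
  quad_norm D u v = 1%Z -> v <> 0%Z -> quad_norm D s0 t0 <> 0%Z ->
  (forall n, quad D (s n) (t n) = quad D s0 t0 * quad D u v ^ n) ->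
  forall (x : nat -> R) (c c' : R), c <> 0 -> c' <> 0 ->
  (forall n, x n = c * quad D (s n) (t n) + c' * quad D (s n) (- t n)) ->
  strong_benford_off_zeros x.
Proof.
intros unit v_neq0 norm_neq0 orbit x c c' c_neq0 c'_neq0 x_eq.
apply not_0_IZR in norm_neq0; rewrite <- quad_mul_conj in norm_neq0.
apply (strong_benford_off_zeros_two_powers x (c * quad D s0 t0) (c' * quad D s0 (- t0))
         (quad D u v) (quad D u (- v))).
- apply Rmult_integral_contrapositive_currified; [easy|].
  intros eq0; apply norm_neq0; now rewrite eq0, Rmult_0_l.
- apply Rmult_integral_contrapositive_currified; [easy|].
  intros eq0; apply norm_neq0; now rewrite eq0, Rmult_0_r.
- now apply quad_unit_abs_conj_neq.
- now apply quad_unit_log10_irrational.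
- apply quad_unit_log10_irrational; [now rewrite quad_norm_opp|lia].
- intros n; rewrite x_eq, (quad_mul_pow_conj _ _ _ _ _ _ _ (orbit n)), orbit; ring.
Qed.

End Quad.

Theorem theorem4p4 (D k u v s0 t0 : Z) (s t : nat -> Z)
  (D_pos : (0 < D)%Z)
  (D_nonsquare : ~ exists m : Z, D = (m ^ 2)%Z)
  (k_neq0 : k <> 0%Z)
  (unit_norm : Zsqrt_norm D 1 (quad D u v))
  (unit_neq1 : quad D u v <> 1)
  (unit_neqN1 : quad D u v <> -1)
  (start_norm : Zsqrt_norm D k (quad D s0 t0))
  (st_def : forall n : nat,
      quad D (s n) (t n) = quad D s0 t0 * quad D u v ^ n) :
  (strong_benford_off_zeros (fun n => IZR (s n)) /\
   ((forall n : nat, s n <> 0%Z) -> strong_benford (fun n => IZR (s n)))) /\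
  (strong_benford_off_zeros (fun n => IZR (t n)) /\
   ((forall n : nat, t n <> 0%Z) -> strong_benford (fun n => IZR (t n)))).
Proof.
apply quad_norm_of_Zsqrt_norm in unit_norm, start_norm; [|easy..].
rewrite <- start_norm in k_neq0.
assert (v_neq0 := quad_unit_nontrivial D u v unit_norm unit_neq1 unit_neqN1).
assert (sqrt_pos : 0 < sqrt (IZR D)) by now apply sqrt_lt_R0, IZR_lt.
assert (combination := strong_benford_off_zeros_quad_combination D D_pos D_nonsquare
                         u v s0 t0 s t unit_norm v_neq0 k_neq0 st_def).
assert (benford_s : strong_benford_off_zeros (fun n => IZR (s n))).
{ apply combination with (/ 2) (/ 2); [lra|lra|].
  intros n; unfold quad; rewrite opp_IZR; lra. }
assert (benford_t : strong_benford_off_zeros (fun n => IZR (t n))).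
{ assert (c_neq0 : / (2 * sqrt (IZR D)) <> 0) by (apply Rinv_neq_0_compat; lra).
  apply combination with (/ (2 * sqrt (IZR D))) (- / (2 * sqrt (IZR D))); [easy|lra|].
  intros n; unfold quad; rewrite opp_IZR; field; lra. }
auto 6 using strong_benford_of_off_zeros, not_0_IZR.
Qed.
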